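(* Let $d\geq 3$ and let $P_d(t)=\sum_{n\geq 1}a_n t^n$, where $a_n$ is the number of directed plateau polyhypercubes of dimension $d$ (of any width $k\geq 1$) with lateral area $n$. Then $$P_d(t)=\frac{t^{d-1}(1-t)^{d-1}}{(1-t)^{2(d-1)}-t^{d-1}}.$$
   Context: Work in $\mathbb{Z}^d$ with orthonormal coordinate system $(0,\vec{i_1},\dots,\vec{i_d})$; a cell is a unit hypercube of the lattice. A polyhypercube of dimension $d$ is a finite union of cells, connected through their $(d-1)$-dimensional faces, defined up to translation. Its width is the number of distinct values of the $\vec{i_1}$-coordinate taken by its cells; its strata are its intersections with the layers of constant $\vec{i_1}$-coordinate. A plateau is a stratum that is a hyperrectangle. An elementary step is a positive move of one unit along one axis. A polyhypercube is directed if every cell can be reached from a distinguished root cell by a path of cells of the polyhypercube using only elementary steps. A directed plateau polyhypercube is a directed polyhypercube all of whose strata are plateaus. The lateral area of a polyhypercube is the sum, over $2\leq l\leq d$, of the areas (numbers of unit squares) of the polyominoes obtained by projecting it onto the planes $(\vec{i_1},\vec{i_l})$. Generating functions are formal power series in $t$. *)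

(* Defs.v *)
From mathcomp Require Import all_boot all_order all_algebra.
Set Implicit Arguments. Unset Strict Implicit. Unset Printing Implicit Defensive.
Import GRing.Theory Num.Theory.
Local Open Scope ring_scope.

(* A cell of Z^d is identified with its lowest corner, a vector of integers
   indexed by 'I_d; coordinate (i : 'I_d) with val i = 0 is the i_1 axis. *)
Definition cell (d : nat) := {ffun 'I_d -> int}.

(* A finite union of cells, given by a (finite) list of cells, read as a set
   (membership only matters). *)
Definition cellset (d : nat) := seq (cell d).

Definition coord1 (d : nat) (c : cell d) : int := \sum_(i < d | val i == 0%N) c i.

Definition adjacent (d : nat) (c c' : cell d) : bool :=
  [exists i, (`|c i - c' i| == 1) && [forall j, (j != i) ==> (c j == c' j)]].

Definition elem_step (d : nat) (c c' : cell d) : bool :=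
  [exists i, (c' i == c i + 1) && [forall j, (j != i) ==> (c j == c' j)]].

Definition reach_in (d : nat) (e : rel (cell d)) (S : cellset d) (c c' : cell d) : Prop :=
  exists p : seq (cell d), [/\ all (fun x => x \in S) p, path e c p & last c p = c'].

(* A polyhypercube (before quotienting by translations): a nonempty finite set of
   cells, connected through (d-1)-dimensional faces. *)
Definition polyhypercube (d : nat) (S : cellset d) : Prop :=
  S <> [::] /\ forall c c', c \in S -> c' \in S -> reach_in (@adjacent d) S c c'.

Definition directed (d : nat) (S : cellset d) : Prop :=
  exists2 r, r \in S & forall c, c \in S -> reach_in (@elem_step d) S r c.

Definition plateau_strata (d : nat) (S : cellset d) : Prop :=
  forall c, c \in S -> exists lo hi : 'I_d -> int,
    forall c' : cell d, coord1 c' = coord1 c ->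
      (c' \in S <-> forall j : 'I_d, val j != 0%N -> lo j <= c' j <= hi j).

Definition directed_plateau_polyhypercube (d : nat) (S : cellset d) : Prop :=
  [/\ polyhypercube S, directed S & plateau_strata S].

(* Lateral area: sum over the axes i_l, l >= 2, of the number of unit squares of
   the projection onto the plane (i_1, i_l). *)
Definition lateral_area (d : nat) (S : cellset d) : nat :=
  (\sum_(l < d | val l != 0%N) size (undup [seq (coord1 c, c l) | c <- S]))%N.

Definition translate_of (d : nat) (S S' : cellset d) : Prop :=
  exists v : 'I_d -> int, forall c : cell d,
    c \in S' <-> exists2 c0, c0 \in S & forall i, c i = c0 i + v i.

Definition num_dpp (d n m : nat) : Prop :=
  exists L : seq (cellset d),
    [/\ size L = m,
        forall S, S \in L -> directed_plateau_polyhypercube S /\ lateral_area S = n,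
        forall i j, (i < m)%N -> (j < m)%N -> i <> j ->
          ~ translate_of (nth [::] L i) (nth [::] L j)
      & forall S, directed_plateau_polyhypercube S -> lateral_area S = n ->
          exists2 S0, S0 \in L & translate_of S0 S].

Definition gf_num (d : nat) : {poly int} := 'X ^+ (d - 1) * (1 - 'X) ^+ (d - 1).
Definition gf_den (d : nat) : {poly int} := (1 - 'X) ^+ (2 * (d - 1)) - 'X ^+ (d - 1).

(* Main.v *)
Require Import Defs.
From mathcomp Require Import all_boot all_order all_algebra.
From mathcomp Require Import zify ring.
Import Order.TTheory.
Import GRing.Theory Num.Theory.
Local Open Scope ring_scope.

(** Strata of a directed plateau polyhypercube occupy consecutive layers, and
    the least corner of each stratum can only be entered from the stratum below,
    hence lies above a cell of it; conversely any such pile of boxes is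
    directed. Along each of the D = d - 1 transverse axes, a non-top stratum is
    thus described by the offset o of the next stratum and by the remaining
    extent r, its side being o + r + 1, and the top stratum by r alone. This
    gives the factors t/(1-t)^2 and t/(1-t), so with U = (t/(1-t)^2)^D the
    generating function is (t/(1-t))^D / (1 - U). The power series are handled
    as polynomials modulo powers of t, using the truncated geometric series. *)

(** * Polynomials modulo powers of X *)

Definition eqmodXn {R : comNzRingType} (n : nat) (p q : {poly R}) :=
  forall i, (i < n)%N -> p`_i = q`_i.

Lemma eqmodXn_trans {R : comNzRingType} n (q p s : {poly R}) :
  eqmodXn n p q -> eqmodXn n q s -> eqmodXn n p s.
Proof. by move=> pq qs i lt_in; rewrite pq ?qs. Qed.

Lemma eqmodXnD {R : comNzRingType} n (p p' q q' : {poly R}) :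
  eqmodXn n p p' -> eqmodXn n q q' -> eqmodXn n (p + q) (p' + q').
Proof. by move=> pp' qq' i lt_in; rewrite !coefD pp' ?qq'. Qed.

Lemma eqmodXnN {R : comNzRingType} n (p p' : {poly R}) :
  eqmodXn n p p' -> eqmodXn n (- p) (- p').
Proof. by move=> pp' i lt_in; rewrite !coefN pp'. Qed.

Lemma eqmodXnM {R : comNzRingType} n (p p' q q' : {poly R}) :
  eqmodXn n p p' -> eqmodXn n q q' -> eqmodXn n (p * q) (p' * q').
Proof.
move=> pp' qq' i lt_in; rewrite !coefM; apply: eq_bigr => j _.
rewrite pp' ?qq' // (leq_ltn_trans _ lt_in) ?leq_subr //.
by rewrite -ltnS.
Qed.

Lemma eqmodXnX {R : comNzRingType} n k (p p' : {poly R}) :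
  eqmodXn n p p' -> eqmodXn n (p ^+ k) (p' ^+ k).
Proof.
by move=> pp'; elim: k => [|k IH] // i; rewrite !exprS; apply: eqmodXnM.
Qed.

Lemma eqmodXn_sum {R : comNzRingType} (I : finType) n (F F' : I -> {poly R}) :
  (forall i, eqmodXn n (F i) (F' i)) -> eqmodXn n (\sum_i F i) (\sum_i F' i).
Proof.
by move=> FF' i lt_in; rewrite !coef_sum; apply: eq_bigr => j _; apply: FF'.
Qed.

Lemma eqmodXn_mulXn {R : comNzRingType} m n (p : {poly R}) :
  (n <= m)%N -> eqmodXn n ('X^m * p) 0.
Proof.
by move=> le_nm i lt_in; rewrite coefXnM coef0 (leq_trans lt_in le_nm).
Qed.

(** * Truncated generating function of piles *)

Definition geom (n : nat) : {poly int} := \sum_(i < n.+1) 'X^i.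
Definition inner_gf (D n : nat) : {poly int} := ('X * geom n ^+ 2) ^+ D.
Definition top_gf (D n : nat) : {poly int} := ('X * geom n) ^+ D.
(** Here [k] counts the strata below the top one. For positive [D] the bound [k < n] is harmless
    through degree [n], since term [k] is divisible by ['X^(D * k.+1)]. *)
Definition stack_gf (D n : nat) : {poly int} :=
  \sum_(k < n) inner_gf D n ^+ k * top_gf D n.


Lemma geom_inv n : eqmodXn n.+1 ((1 - 'X) * geom n) 1.
Proof.
rewrite /geom -[(1 - 'X)]opprB mulNr -subrX1 opprB => i lt_in.
by rewrite coefB coefXn (ltn_eqF lt_in) subr0.
Qed.

Lemma geom_stable m n : (m <= n)%N -> eqmodXn m.+1 (geom n) (geom m).
Proof.
move=> le_mn i lt_im.
have coefG k : (i < k.+1)%N -> (geom k)`_i = 1.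
  move=> lt_ik; rewrite /geom coef_sum (bigD1 (Ordinal lt_ik)) //= coefXn eqxx.
  rewrite big1 ?addr0 // => j; rewrite coefXn -val_eqE /= eq_sym.
  by move=> /negPf->.
by rewrite !coefG // (leq_trans lt_im).
Qed.

Lemma stack_gf_tail D m n k : (0 < D)%N -> (m <= k)%N ->
  eqmodXn m.+1 (inner_gf D n ^+ k * top_gf D n) 0.
Proof.
move=> D_gt0 le_mk; rewrite /inner_gf /top_gf -exprM !exprMn.
rewrite mulrACA -exprD; apply: eqmodXn_mulXn; nia.
Qed.

(** Coefficients of different degrees are counted with different truncation orders; this brings them
    to a common one. *)
Lemma stack_gf_stable D m n : (0 < D)%N -> (m <= n)%N ->
  eqmodXn m.+1 (stack_gf D n) (stack_gf D m).
Proof.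
move=> D_gt0 le_mn; have Gmn := geom_stable _ _ le_mn.
rewrite /stack_gf -(subnKC le_mn); set p := (n - m)%N.
rewrite big_split_ord /= -[X in eqmodXn _ _ X]addr0.
(* Writing [n] as [m + p] to split the range also changed the truncation order in the summands; it
   is restored here. *)
have -> : (m + p)%N = n by rewrite subnKC.
apply: eqmodXnD.
  apply: eqmodXn_sum => i; rewrite /inner_gf /top_gf.
  by apply: eqmodXnM; do ?[apply: eqmodXnX]; apply: eqmodXnM => //;
     apply: eqmodXnX.
apply: (@eqmodXn_trans _ _ (\sum_(i < p) 0)); last by rewrite big1.
by apply: eqmodXn_sum => i; apply: stack_gf_tail; rewrite ?leq_addr.
Qed.

(** Let [U] be [inner_gf D n]. Modulo ['X^n.+1], the denominator is [(1 - 'X) ^+ (2 * D) * (1 - U)];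
    the sum of powers of [U] telescopes against [1 - U], and the leftover term in [U ^+ n]
    vanishes. *)
Lemma stack_gf_eq D n : (0 < D)%N ->
  eqmodXn n.+1 (stack_gf D n * gf_den D.+1) (gf_num D.+1).
Proof.
move=> D_gt0; rewrite /gf_den /gf_num subSS subn0.
set Y : {poly int} := 1 - 'X.
have YG k : eqmodXn n.+1 ((Y * geom n) ^+ k) 1.
  by rewrite -[X in eqmodXn _ _ X](expr1n _ k); apply: eqmodXnX; apply: geom_inv.
have YU : eqmodXn n.+1 ('X^D) (Y ^+ (2 * D) * inner_gf D n).
  have -> : Y ^+ (2 * D) * inner_gf D n = 'X^D * (Y * geom n) ^+ (2 * D).
    by rewrite /inner_gf !exprM -!exprMn; congr (_ ^+ D); ring.
  by rewrite -{1}['X^D]mulr1; apply: eqmodXnM => // i lt_in; rewrite YG.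
have YV : eqmodXn n.+1 (Y ^+ (2 * D) * top_gf D n) ('X^D * Y ^+ D).
  have -> : Y ^+ (2 * D) * top_gf D n = 'X^D * Y ^+ D * (Y * geom n) ^+ D.
    by rewrite /top_gf !exprMn mulnC muln2 -addnn exprD; ring.
  by rewrite -[X in eqmodXn _ _ X]mulr1; apply: eqmodXnM.
apply: (@eqmodXn_trans _ _
  (stack_gf D n * (Y ^+ (2 * D) - Y ^+ (2 * D) * inner_gf D n))).
  by apply: eqmodXnM => //; apply: eqmodXnD => //; apply: eqmodXnN.
have -> : stack_gf D n * (Y ^+ (2 * D) - Y ^+ (2 * D) * inner_gf D n)
   = Y ^+ (2 * D) * top_gf D n
     - Y ^+ (2 * D) * (inner_gf D n ^+ n * top_gf D n).
  have tele := subrX1 (inner_gf D n) n.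
  rewrite /stack_gf -mulr_suml; set s := \sum_(_ < _) _ in tele *.
  have -> : inner_gf D n ^+ n = 1 + (inner_gf D n - 1) * s by rewrite -tele; ring.
  ring.
rewrite -[X in eqmodXn _ _ X]subr0; apply: eqmodXnD => //; apply: eqmodXnN.
rewrite -[X in eqmodXn _ _ X](mulr0 (Y ^+ (2 * D))).
by apply: eqmodXnM => //; apply: stack_gf_tail.
Qed.

(** * Directed sets of cells *)

Lemma elem_stepP {d} (c c' : cell d) :
  reflect (exists i, c' = [ffun k => c k + (k == i)%:Z]) (elem_step c c').
Proof.
apply: (iffP existsP) => -[i].
  case/andP=> /eqP ci /forallP cj; exists i; apply/ffunP => k; rewrite ffunE.
  case: eqVneq => [->//|ki]; rewrite addr0; apply/esym/eqP.
  by move/implyP: (cj k); apply.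
move=> ->; exists i; rewrite ffunE !eqxx /=; apply/forallP => j.
by apply/implyP => /negPf ji; rewrite ffunE ji addr0.
Qed.

Lemma elem_step_adjacent {d} (c c' : cell d) :
  elem_step c c' -> adjacent c c' && adjacent c' c.
Proof.
case/elem_stepP=> i ->; apply/andP; split; apply/existsP; exists i;
  rewrite ffunE eqxx; (apply/andP; split; first by apply/eqP; lia);
  by apply/forallP => j; apply/implyP => /negPf ji; rewrite ffunE ji addr0.
Qed.

Lemma reach_in_trans {d} (e : rel (cell d)) S b a c :
  reach_in e S a b -> reach_in e S b c -> reach_in e S a c.
Proof.
move=> [p [Sp ep lp]] [q [Sq eq lq]]; exists (p ++ q).
by rewrite all_cat Sp Sq cat_path ep last_cat lp eq lq.
Qed.

Lemma reach_in1 {d} (e : rel (cell d)) S a b :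
  b \in S -> e a b -> reach_in e S a b.
Proof. by move=> Sb eab; exists [:: b]; rewrite /= Sb eab. Qed.

(** An elementary step is an adjacency in both directions, so every cell is joined to the root both
    ways. *)
Lemma directed_polyhypercube {d} (S : cellset d) :
  directed S -> polyhypercube S.
Proof.
move=> [r Sr dS].
have adjr c : c \in S -> reach_in (@adjacent d) S r c /\ reach_in (@adjacent d) S c r.
  move=> /dS [p]; elim/last_ind: p c => [|p x IH] c [].
    by move=> _ _ <-; split; exists [::].
  rewrite all_rcons rcons_path last_rcons => /andP[Sx Sp] /andP[ep ex] <-.
  have [rl lr] := IH _ (And3 Sp ep erefl).
  have [a1 a2] := andP (elem_step_adjacent _ _ ex).
  have Sl : last r p \in S.
    case/lastP: p Sp {IH ep ex rl lr a1 a2} => [|p y] //=.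
    by rewrite all_rcons last_rcons => /andP[].
  by split; [apply: reach_in_trans rl _ | apply: reach_in_trans lr]; apply: reach_in1.
split=> [S0|c c' Sc Sc']; first by rewrite S0 in Sr.
exact: reach_in_trans (adjr c Sc).2 (adjr c' Sc').1.
Qed.

(** Passing to a predecessor lowers the sum of the coordinates relative to [r] by one. This sum is
    never negative, so the descent ends, necessarily at [r]. *)
Lemma directed_by_pred {d} (S : cellset d) (r : cell d) :
  r \in S -> (forall (c : cell d) (i : 'I_d), c \in S -> r i <= c i) ->
  (forall c : cell d, c \in S -> c != r -> exists2 c', c' \in S & elem_step c' c) ->
  directed S.
Proof.
move=> Sr Sge pred; exists r => // c.
have [m] := ubnP (absz (\sum_i (c i - r i))%R); elim: m c => // m IH c lt_m Sc.
have [->|c_r] := eqVneq c r; first by exists [::].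
have [c' Sc' cc'] := pred c Sc c_r.
apply: (@reach_in_trans _ _ _ c'); last exact: reach_in1.
apply: IH => //; case/elem_stepP: cc' lt_m => i ->.
(* The sign matters because the induction is on the absolute value of the sum. *)
have c'_ge0 : 0 <= \sum_i (c' i - r i).
  by apply: sumr_ge0 => j _; rewrite subr_ge0 Sge.
have -> : \sum_j ([ffun k => c' k + (k == i)%:Z] j - r j)
        = \sum_j (c' j - r j) + 1.
  rewrite -(big_pred1_eq (GRing.add) i (fun=> 1)) [X in _ = _ + X]big_mkcond -big_split /=.
  by apply: eq_bigr => j _; rewrite ffunE; case: eqP => _ /=; lia.
lia.
Qed.

(** The predecessor is the penultimate cell of a path from the root. With [directed_ge], this gives
    the converse of [directed_by_pred]. *)
Lemma directed_pred {d} (S : cellset d) (r : cell d) : r \in S ->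
  (forall c, c \in S -> reach_in (@elem_step d) S r c) ->
  forall c : cell d, c \in S -> c != r ->
    exists2 c' : cell d, c' \in S & elem_step c' c.
Proof.
move=> Sr dS c /dS [p []]; case/lastP: p => [_ _ <-|p x]; first by rewrite eqxx.
rewrite all_rcons rcons_path last_rcons => /andP[Sx Sp] /andP[ep ex] <- _.
exists (last r p) => //; case/lastP: p Sp {ep ex} => [|p y] //=.
by rewrite all_rcons last_rcons => /andP[].
Qed.

Lemma directed_ge {d} (S : cellset d) (r : cell d) :
  (forall c, c \in S -> reach_in (@elem_step d) S r c) ->
  forall (c : cell d) (i : 'I_d), c \in S -> r i <= c i.
Proof.
move=> dS c i /dS [p []]; elim/last_ind: p c => [|p x IH] c; first by move=> _ _ <-.
rewrite all_rcons rcons_path last_rcons => /andP[Sx Sp] /andP[ep ex] <-.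
have le := IH _ Sp ep erefl; case/elem_stepP: ex => j ->; rewrite ffunE; lia.
Qed.

Lemma cell_addE {d} (c v : cell d) i : (c + v) i = c i + v i.
Proof. by rewrite ffunE. Qed.

Lemma cell_subE {d} (c v : cell d) i : (c - v) i = c i - v i.
Proof. by rewrite !ffunE. Qed.

(** * Piles of boxes *)

Section Stack.
Context {D : nat}.
Implicit Types (o r : nat -> 'I_D -> nat) (c v : cell D.+1) (S : cellset D.+1).

Lemma coord1E c : coord1 c = c ord0.
Proof.
rewrite /coord1 big_mkcond big_ord_recl /= big1 ?addr0 // => i _.
Qed.

Lemma cellP c c' :
  c ord0 = c' ord0 -> (forall l, c (lift ord0 l) = c' (lift ord0 l)) -> c = c'.
Proof. by move=> c0 cl; apply/ffunP => i; case: (unliftP ord0 i) => [l ->|->]. Qed.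

Definition mkcell (x : int) (y : 'I_D -> int) : cell D.+1 :=
  [ffun i => if unlift ord0 i is Some l then y l else x].

Lemma mkcell0 x y : mkcell x y ord0 = x.
Proof. by rewrite ffunE unlift_none. Qed.

Lemma mkcellS x y l : mkcell x y (lift ord0 l) = y l.
Proof. by rewrite ffunE liftK. Qed.

(* Transverse coordinates of the least corner of stratum j, the least corner of
   stratum 0 being the origin. *)
Definition base o (j : nat) (l : 'I_D) : nat := (\sum_(i < j) o i l)%N.

(** Since the extent is split as [o j l + r j l], the least corner of the next stratum, at offset
    [o j l], automatically lies above stratum [j]: the natural numbers [o] and [r] are free
    parameters. *)
Definition stack (w : nat) o r (c : cell D.+1) : Prop :=
  exists2 j : nat, (j < w)%N & c ord0 = j%:Z /\
    forall l, (base o j l)%:Z <= c (lift ord0 l)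
              <= (base o j l + (o j l + r j l))%N%:Z.

Lemma base0 o l : base o 0 l = 0%N.
Proof. by rewrite /base big_ord0. Qed.

Lemma baseS o j l : base o j.+1 l = (base o j l + o j l)%N.
Proof. by rewrite /base big_ord_recr. Qed.

Lemma stack_at w o r (j : nat) (y : 'I_D -> int) :
  stack w o r (mkcell j%:Z y) <-> (j < w)%N /\
    forall l, (base o j l)%:Z <= y l <= (base o j l + (o j l + r j l))%N%:Z.
Proof.
split=> [[j' lt_j' []]|[lt_jw yP]].
  rewrite mkcell0 => -[->] yP; split=> // l.
  by have := yP l; rewrite mkcellS.
by exists j => //; rewrite mkcell0; split=> // l; rewrite mkcellS.
Qed.

Lemma stack_dpp w o r S : (0 < w)%N ->
  (forall c, c \in S <-> stack w o r c) -> directed_plateau_polyhypercube S.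
Proof.
move=> w_gt0 SP.
suff dS : directed S.
  split=> //; first exact: directed_polyhypercube.
  move=> c /SP [j lt_jw [cj _]].
  (* The bound at coordinate 0 is a dummy, as [plateau_strata] constrains only the other
     coordinates. *)
  exists (fun i => if unlift ord0 i is Some l then (base o j l)%:Z else 0).
  exists (fun i => if unlift ord0 i is Some l
                   then (base o j l + (o j l + r j l))%N%:Z else 0).
  move=> c'; rewrite !coord1E cj => c'j; split.
    case/SP=> j' _ []; rewrite c'j => -[<-] c'P i.
    by case: (unliftP ord0 i) => [l -> _|->//]; rewrite ?liftK.
  move=> c'P; apply/SP; exists j => //; split=> // l.
  by have := c'P (lift ord0 l) isT; rewrite liftK.
apply: (@directed_by_pred _ _ (mkcell 0 (fun=> 0))).
- by apply/SP/stack_at; split=> // l; rewrite base0.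
- move=> c i /SP [j _ [c0 cP]]; case: (unliftP ord0 i) => [l ->|->].
    by rewrite mkcellS; have := cP l; lia.
  by rewrite mkcell0 c0.
move=> c /SP [j lt_jw [c0 cP]] c_neq0.
have pred i c' : c' = [ffun k => c k - (k == i)%:Z] -> elem_step c' c.
  by move=> ->; apply/elem_stepP; exists i; apply/ffunP=> k; rewrite !ffunE subrK.
(* A cell that is not the least corner of its stratum has a predecessor inside the stratum; a least
   corner is the root or is entered from the layer below. *)
have [/existsP [l ltl]|/existsPn all_eq] :=
    boolP [exists l, (base o j l)%:Z < c (lift ord0 l)].
  exists ([ffun k => c k - (k == lift ord0 l)%:Z] : cell D.+1); last exact: (pred (lift ord0 l)).
  apply/SP; exists j => //; split=> [|l']; rewrite !ffunE ?c0 //=.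
    by rewrite subr0.
  have := cP l'; case: eqVneq => [/lift_inj ->|_] /=; lia.
have cE l : c (lift ord0 l) = (base o j l)%:Z.
  by have := all_eq l; have := cP l; lia.
case: j lt_jw c0 cP cE {all_eq} => [|j] lt_jw c0 cP cE.
  case/negP: c_neq0; apply/eqP/cellP => [|l]; rewrite ?mkcell0 ?c0 //.
  by rewrite mkcellS cE base0.
exists ([ffun k => c k - (k == ord0)%:Z] : cell D.+1); last exact: (pred ord0).
apply/SP; exists j; first exact: ltnW; split=> [|l].
  by rewrite !ffunE c0 eqxx /=; lia.
by have := cP l; rewrite !ffunE /= cE baseS; lia.
Qed.

Definition area w o r : nat := (\sum_(j < w) \sum_l (o j l + r j l).+1)%N.

(** In the plane of [i_1] and axis [l], each stratum projects onto a segment of squares as long as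
    its side, and distinct strata onto distinct layers, so the counts add up. *)
Lemma lateral_area_stack w o r v S :
  (forall c, c \in S <-> stack w o r (c - v)) -> lateral_area S = area w o r.
Proof.
move=> SP; rewrite /lateral_area big_mkcond big_ord_recl /= add0n.
rewrite /area exchange_big; apply: eq_bigr => l _ /=.
pose pt (j k : nat) : int * int :=
  (v ord0 + j%:Z, v (lift ord0 l) + (base o j l + k)%N%:Z).
pose s := [seq pt j k | j <- iota 0 w, k <- iota 0 (o j l + r j l).+1].
have sE p : (exists2 c : cell D.+1, c \in S & p = (coord1 c, c (lift ord0 l)))
              <-> p \in s.
  split=> [[c /SP [j lt_jw []]]|/allpairsPdep [j [k []]]].
    rewrite cell_subE => c0 /(_ l); rewrite cell_subE => cl ->; rewrite coord1E.
    apply/allpairsPdep; exists j.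
    exists (absz (c (lift ord0 l) - v (lift ord0 l) - (base o j l)%:Z)%R).
    rewrite !mem_iota; split; [lia|lia|].
    by rewrite /pt; congr pair; lia.
  rewrite !mem_iota => lt_jw lt_k ->.
  (* A cell over the square [pt j k]: [k] units from the least corner along axis [l], none along the
     others. *)
  exists (mkcell j%:Z (fun l' => (base o j l' + (if l' == l then k else 0))%N%:Z) + v).
    apply/SP; rewrite addrK; apply/stack_at; split; first lia.
    by move=> l'; case: eqP => [->|_]; lia.
  by rewrite coord1E !cell_addE mkcell0 mkcellS eqxx; congr pair; rewrite addrC.
transitivity (size s).
  apply: perm_size; apply: uniq_perm; first exact: undup_uniq.
    apply: allpairs_uniq_dep => [|j _|]; rewrite ?iota_uniq //.
    move=> [j k] [j' k'] _ _ [] /addrI [jj']; rewrite -jj' => /addrI [].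
    by move=> /addnI ->.
  by move=> p; rewrite mem_undup; apply/mapP/idP => /sE.
rewrite size_allpairs_dep sumnE big_map -[w in LHS]subn0 -/(index_iota 0 w) big_mkord.
by apply: eq_bigr => j _; rewrite size_iota.
Qed.

Lemma stack_list w o r :
  exists S : cellset D.+1, forall c, c \in S <-> stack w o r c.
Proof.
pose F (j : nat) (g : {dffun forall l : 'I_D, 'I_(o j l + r j l).+1}) :=
  mkcell j%:Z (fun l => (base o j l + g l)%N%:Z).
exists [seq F j g | j <- iota 0 w,
          g <- enum {: {dffun forall l : 'I_D, 'I_(o j l + r j l).+1}}].
move=> c; split.
  case/allpairsPdep => j [g []]; rewrite mem_iota => lt_jw _ ->.
  by apply/stack_at; split=> // l; case: (g l) => m /= lt_m; lia.
case=> j lt_jw [c0 cP]; apply/allpairsPdep; exists j.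
exists [ffun l => inord (absz (c (lift ord0 l) - (base o j l)%:Z)%R)].
split; [by rewrite mem_iota | by rewrite mem_enum |].
apply: cellP => [|l]; rewrite /F ?mkcell0 // mkcellS ffunE.
by have := cP l => cl; rewrite inordK; lia.
Qed.

(** The bottom layers fix [v] along [i_1] and the top layers fix the width. The ends of each box
    give its base and the sum of offset and extent; differences of consecutive bases give the
    offsets, except at the top, where they are normalized to 0. *)
Lemma stack_inj w o r w' o' r' v : (0 < w)%N -> (0 < w')%N ->
  (forall l, o w.-1 l = 0%N) -> (forall l, o' w'.-1 l = 0%N) ->
  (forall c, stack w o r (c - v) <-> stack w' o' r' c) ->
  w = w' /\ forall j l, (j < w)%N -> o j l = o' j l /\ r j l = r' j l.
Proof.
move=> w_gt0 w'_gt0 o_top o'_top eqS.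
have shift x y : stack w o r (mkcell x y) -> stack w' o' r' (mkcell x y + v).
  by move=> h; apply/eqS; rewrite addrK.
have shift' x y : stack w' o' r' (mkcell x y) -> stack w o r (mkcell x y - v).
  by move/eqS.
have lowP j : (j < w)%N -> stack w o r (mkcell j%:Z (fun l => (base o j l)%:Z)).
  by move=> ?; apply/stack_at; split=> // l; lia.
have lowP' j : (j < w')%N -> stack w' o' r' (mkcell j%:Z (fun l => (base o' j l)%:Z)).
  by move=> ?; apply/stack_at; split=> // l; lia.
have v0_ge : 0 <= v ord0.
  have [j _ []] := shift _ _ (lowP 0%N w_gt0); rewrite cell_addE mkcell0; lia.
have v0_le : v ord0 <= 0.
  have [j _ []] := shift' _ _ (lowP' 0%N w'_gt0); rewrite cell_subE mkcell0; lia.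
have v0 : v ord0 = 0 by lia.
have ww' : w = w'.
  have [j lt_j []] := shift _ _ (lowP w.-1 ltac:(lia)).
  have [j' lt_j' []] := shift' _ _ (lowP' w'.-1 ltac:(lia)).
  rewrite cell_subE cell_addE !mkcell0; lia.
move: w'_gt0 o'_top; rewrite -{}ww' in eqS shift shift' lowP lowP' * => _ o'_top.
have box j y : (j < w)%N ->
    (forall l, (base o j l)%:Z <= y l <= (base o j l + (o j l + r j l))%N%:Z) <->
    (forall l, (base o' j l)%:Z <= y l + v (lift ord0 l)
               <= (base o' j l + (o' j l + r' j l))%N%:Z).
  move=> lt_jw.
  have vE : mkcell j%:Z (fun l => y l + v (lift ord0 l)) - v = mkcell j%:Z y.
    by apply: cellP => [|l]; rewrite cell_subE ?mkcell0 ?mkcellS ?v0 ?subr0 ?addrK.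
  have := eqS (mkcell j%:Z (fun l => y l + v (lift ord0 l))).
  rewrite vE => eqj; split=> H.
    by have [] := (stack_at w o' r' j _).1 (eqj.1 ((stack_at w o r j y).2 (conj lt_jw H))).
  by have [] := (stack_at w o r j y).1 (eqj.2 ((stack_at w o' r' j _).2 (conj lt_jw H))).
have ends j l : (j < w)%N ->
   (base o j l)%:Z + v (lift ord0 l) = (base o' j l)%:Z /\
   (o j l + r j l = o' j l + r' j l)%N.
  move=> lt_jw.
  (* Testing both extreme corners of each box for membership in the other gives opposite
     inequalities. *)
  have [b1 _] := box j (fun l => (base o j l)%:Z) lt_jw.
  have [b2 _] := box j (fun l => (base o j l + (o j l + r j l))%N%:Z) lt_jw.
  have [_ b3] := box j (fun l => (base o' j l)%:Z - v (lift ord0 l)) lt_jw.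
  have [_ b4] := box j (fun l => (base o' j l + (o' j l + r' j l))%N%:Z - v (lift ord0 l)) lt_jw.
  have := b1 (fun l => ltac:(lia)) l; have := b2 (fun l => ltac:(lia)) l.
  have := b3 (fun l => ltac:(lia)) l; have := b4 (fun l => ltac:(lia)) l.
  lia.
have vl l : v (lift ord0 l) = 0.
  by have [] := ends 0%N l w_gt0; rewrite !base0; lia.
split=> // j l lt_jw; have [bj sj] := ends j l lt_jw.
suff : o j l = o' j l by lia.
have [lt_j1|ge_j1] := ltnP j.+1 w.
  by have [] := ends j.+1 l lt_j1; rewrite !baseS vl; move: bj; rewrite vl; lia.
have -> : j = w.-1 by lia.
by rewrite o_top o'_top.
Qed.

Lemma dpp_stack S : directed_plateau_polyhypercube S ->
  exists w o r v, [/\ (0 < w)%N, forall l, o w.-1 l = 0%N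
    & forall c, c \in S <-> stack w o r (c - v)].
Proof.
case=> _ dirS pS.
have [v [Sv dS]] : exists v, v \in S /\
    forall c, c \in S -> reach_in (@elem_step D.+1) S v c.
  by case: dirS => v; exists v.
have Sge := directed_ge _ _ dS; have Spred := directed_pred _ _ Sv dS.
(* Height above the root; the absolute value loses nothing on [S], where the root is coordinatewise
   least. *)
pose lev c := absz (c ord0 - v ord0)%R.
have levE c : c \in S -> c ord0 = v ord0 + (lev c)%:Z.
  by move=> Sc; have := Sge c ord0 Sc; rewrite /lev; lia.
have S_gt0 : (0 < #|'I_(size S)|)%N by rewrite card_ord; case: (S) Sv.
have [i1 k_max] := @bigop.eq_bigmax 'I_(size S) (fun i => lev (nth v S i)) S_gt0.
set c1 := nth v S i1 in k_max; set k := lev c1 in k_max.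
have Sc1 : c1 \in S by rewrite mem_nth.
have lev_le c : c \in S -> (lev c <= k)%N.
  move=> Sc; rewrite -k_max; have lt_c : (index c S < size S)%N by rewrite index_mem.
  by rewrite (leq_trans _ (leq_bigmax (Ordinal lt_c))) //= nth_index.
(* A path from the root climbs at most one layer per step, so it skips none. *)
have lev_all c : c \in S -> forall j : nat,
    (j <= lev c)%N -> exists2 c', c' \in S & lev c' = j.
  move=> /dS [p []]; elim/last_ind: p c => [|p x IH] c.
    move=> _ _ <- j; rewrite /lev subrr leqn0 => /eqP ->; exists v => //.
    by rewrite /lev subrr.
  rewrite all_rcons rcons_path last_rcons => /andP[Sx Sp] /andP[ep ex] <- j.
  rewrite leq_eqVlt => /orP[/eqP ->|lt_j]; first by exists x.
  apply: (IH _ Sp ep erefl); apply: leq_trans (_ : (lev x).-1 <= _)%N; first lia.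
  by case/elem_stepP: ex lt_j => i ->; rewrite /lev ffunE; lia.
have strata (j : 'I_k.+1) : exists b : ('I_D -> int) * ('I_D -> int),
    (forall y, mkcell (v ord0 + (j : nat)%:Z) y \in S
               <-> forall l, b.1 l <= y l <= b.2 l) /\
    (forall l, b.1 l <= b.2 l).
  have [c Sc lev_c] := lev_all c1 Sc1 j (ltn_ord j).
  have [lo [hi cP]] := pS c Sc.
  pose b := (fun l => lo (lift ord0 l), fun l => hi (lift ord0 l)); exists b.
  have bP y : mkcell (v ord0 + (j : nat)%:Z) y \in S <-> forall l, b.1 l <= y l <= b.2 l.
    have := cP (mkcell (v ord0 + (j : nat)%:Z) y).
    rewrite !coord1E mkcell0 (levE c Sc) lev_c => /(_ erefl) yP; split=> [/yP h l|h].
      by have := h (lift ord0 l) isT; rewrite mkcellS.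
    by apply/yP => i; case: (unliftP ord0 i) => [l ->|->//]; rewrite mkcellS h.
  split=> // l; have := (bP (fun l => c (lift ord0 l))).1.
  rewrite (_ : mkcell _ _ = c); first by move=> /(_ Sc l) /andP[]; apply: le_trans.
  by apply: cellP => [|l']; rewrite ?mkcell0 ?mkcellS // (levE c Sc) lev_c.
have [b bP] := fin_all_exists strata.
(* Beyond [k], [inord] returns an irrelevant index; only [j <= k] is used. *)
pose lo j l := (b (inord j)).1 l; pose hi j l := (b (inord j)).2 l.
have SP j y : (j <= k)%N -> mkcell (v ord0 + j%:Z) y \in S
    <-> forall l, lo j l <= y l <= hi j l.
  by move=> le_jk; have [] := bP (inord j); rewrite inordK.
have lo_hi j l : (j <= k)%N -> lo j l <= hi j l.
  by move=> le_jk; have [_] := bP (inord j); apply.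
have lo_in j : (j <= k)%N -> mkcell (v ord0 + j%:Z) (lo j) \in S.
  by move=> le_jk; apply/SP => // l; rewrite lexx lo_hi.
(* The root lies in stratum 0 and is coordinatewise least, hence is its least corner. *)
have lo0 l : lo 0%N l = v (lift ord0 l).
  have vE : mkcell (v ord0 + 0%:Z) (fun l => v (lift ord0 l)) = v.
    by apply: cellP => [|l']; rewrite ?mkcell0 ?mkcellS ?addr0.
  have := (SP 0%N (fun l => v (lift ord0 l)) isT).1; rewrite vE => /(_ Sv l).
  by have := Sge _ (lift ord0 l) (lo_in 0%N isT); rewrite mkcellS; lia.
(* The least corner of a stratum can only be entered from the stratum below. *)
have lo_step j l : (j < k)%N -> lo j l <= lo j.+1 l <= hi j l.
  move=> lt_jk; have [|c' Sc' /elem_stepP [i cE]] := Spred _ (lo_in _ lt_jk).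
    by apply/eqP => /(congr1 (fun c : cell D.+1 => c ord0)); rewrite mkcell0; lia.
  have cc' k' : mkcell (v ord0 + j.+1%:Z) (lo j.+1) k' = c' k' + (k' == i)%:Z.
    by rewrite cE ffunE.
  have c0 := cc' ord0; have cl l' := cc' (lift ord0 l').
  case: (unliftP ord0 i) c0 cl {cE cc'} => [l0 ->|->] c0 cl; last first.
    have c'E : c' = mkcell (v ord0 + j%:Z) (lo j.+1).
      apply: cellP => [|l']; rewrite ?mkcell0 ?mkcellS.
        by move: c0; rewrite mkcell0 eqxx /=; lia.
      by have := cl l'; rewrite mkcellS /= addr0.
    by move: Sc'; rewrite c'E => /(SP _ _ (ltnW lt_jk)) /(_ l).
  (* A step along a transverse axis [l0] would start in the same stratum, one unit below its lower
     bound. *)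
  have c'E : c' = mkcell (v ord0 + j.+1%:Z) (fun l => c' (lift ord0 l)).
    apply: cellP => [|l']; rewrite ?mkcell0 ?mkcellS //.
    by move: c0; rewrite mkcell0 /= addr0.
  move: Sc'; rewrite c'E => /(SP _ _ lt_jk) /(_ l0).
  by have := cl l0; rewrite mkcellS eqxx /=; lia.
(* By [lo_step] both differences are nonnegative below the top, so [absz] keeps their values; the
   top offset is set to 0. *)
pose o j l := if (j < k)%N then absz (lo j.+1 l - lo j l)%R else 0%N.
pose r j l := absz (hi j l - lo j l - (o j l)%:Z)%R.
have baseE j l : (j <= k)%N -> lo j l = v (lift ord0 l) + (base o j l)%:Z.
  elim: j => [|j IH] le_jk; first by rewrite base0 lo0 addr0.
  have oE : o j l = absz (lo j.+1 l - lo j l)%R by rewrite /o le_jk.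
  by rewrite baseS oE; have := IH (ltnW le_jk); have := lo_step _ l le_jk; lia.
have hiE j l : (j <= k)%N ->
    hi j l = v (lift ord0 l) + (base o j l + (o j l + r j l))%N%:Z.
  move=> le_jk; have lj := baseE _ l le_jk.
  suff oj : (o j l)%:Z <= hi j l - lo j l.
    have rE : r j l = absz (hi j l - lo j l - (o j l)%:Z)%R by [].
    lia.
  rewrite /o; case: ifP => [lt_jk|_]; last by have := lo_hi _ l le_jk; lia.
  by have := lo_step _ l lt_jk; lia.
exists k.+1, o, r, v; split=> // [l|c]; first by rewrite /o ltnn.
have cE (j : nat) : c ord0 - v ord0 = j%:Z ->
    c = mkcell (v ord0 + j%:Z) (fun l => c (lift ord0 l)).
  by move=> cj; apply: cellP => [|l]; rewrite ?mkcell0 ?mkcellS //; lia.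
split=> [Sc|[j le_jk []]].
  have c0 := levE c Sc; have le_k := lev_le c Sc; exists (lev c) => //.
  rewrite cell_subE; split=> [|l]; first lia.
  have cl : mkcell (v ord0 + (lev c)%:Z) (fun l => c (lift ord0 l)) \in S.
    by rewrite -cE //; lia.
  have := (SP _ _ le_k).1 cl l; rewrite cell_subE (hiE _ _ le_k) (baseE _ _ le_k).
  lia.
rewrite cell_subE => /cE cj cP; rewrite cj; apply/SP => // l.
by have := cP l; rewrite cell_subE (hiE _ _ le_jk) (baseE _ _ le_jk); lia.
Qed.

End Stack.

(** * Counting *)

(* Codes of piles of width k + 1 with parameters at most n: the pairs are the
   (offset, extent) of the lower strata, the second component the extents of
   the top one. *)
Definition strata_code (D n k : nat) : finType :=
  ({ffun 'I_k * 'I_D -> 'I_n.+1 * 'I_n.+1} * {ffun 'I_D -> 'I_n.+1})%type.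

(** Widths are at most [n]. By [area_width] and [area_ge], the bounds on width and parameters
    exclude no pile of area [n] when [D] is positive. *)
Definition stack_code (D n : nat) : finType := {k : 'I_n & strata_code D n k}.

Section Code.
Context {D n : nat}.

(** [insub] fails from [k] on, which yields the zero offset required of the top stratum. *)
Definition offset {k} (x : strata_code D n k) (j : nat) (l : 'I_D) : nat :=
  if insub j is Some j' then (x.1 (j', l)).1 else 0%N.

Definition extent {k} (x : strata_code D n k) (j : nat) (l : 'I_D) : nat :=
  if insub j is Some j' then (x.1 (j', l)).2 else x.2 l.

Definition code_area {k} (x : strata_code D n k) : nat :=
  area k.+1 (offset x) (extent x).

Lemma code_areaE k (x : strata_code D n k) :
  code_area x = (\sum_p ((x.1 p).1 + (x.1 p).2).+1 + \sum_l (x.2 l).+1)%N.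
Proof.
rewrite /code_area /area big_ord_recr /=; congr addn.
  rewrite (eq_bigr (fun p => ((x.1 (p.1, p.2)).1 + (x.1 (p.1, p.2)).2).+1)); last by case.
  rewrite -(pair_big xpredT xpredT (fun i l => ((x.1 (i, l)).1 + (x.1 (i, l)).2).+1)) /=.
  apply: eq_bigr => i _; apply: eq_bigr => l _.
  by rewrite /offset /extent valK.
by apply: eq_bigr => l _; rewrite /offset /extent insubF ?ltnn.
Qed.

(** The area is a sum of one independent contribution per stratum and axis, so the sum of monomials
    factors: ['X * geom n ^+ 2] for a pair of parameters, ['X * geom n] for a top extent. *)
Lemma code_gf k :
  \sum_(x : strata_code D n k) 'X^(code_area x) = inner_gf D n ^+ k * top_gf D n.
Proof.
pose F (f : {ffun 'I_k * 'I_D -> 'I_n.+1 * 'I_n.+1}) : {poly int} :=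
  \prod_p 'X ^+ ((f p).1 + (f p).2).+1.
pose H (g : {ffun 'I_D -> 'I_n.+1}) : {poly int} := \prod_l 'X ^+ (g l).+1.
transitivity ((\sum_f F f) * (\sum_g H g)).
  rewrite big_distrlr pair_big /=; apply: eq_bigr => x _.
  by rewrite code_areaE exprD /F /H !prodrXr.
rewrite /F /H -(bigA_distr_bigA (fun=> fun ab : 'I_n.+1 * 'I_n.+1 => 'X ^+ (ab.1 + ab.2).+1)).
rewrite -(bigA_distr_bigA (fun=> fun a : 'I_n.+1 => 'X ^+ a.+1)) !prodr_const.
rewrite card_prod !card_ord /inner_gf /top_gf mulnC exprM.
have XG : \sum_(a < n.+1) 'X ^+ a.+1 = 'X * geom n :> {poly int}.
  by rewrite /geom mulr_sumr; apply: eq_bigr => i _; rewrite exprS.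
rewrite XG; congr (_ ^+ _ ^+ _ * _).
rewrite expr2 /geom big_distrlr pair_big mulr_sumr /=.
by apply: eq_bigr => ab _; rewrite exprS exprD.
Qed.

Lemma card_code m :
  #|[pred t : stack_code D n | code_area (tagged t) == m]|%:Z = (stack_gf D n)`_m.
Proof.
have -> : stack_gf D n = \sum_(t : stack_code D n) 'X^(code_area (tagged t)).
  rewrite /stack_gf (eq_bigr (fun k : 'I_n => \sum_(x : strata_code D n k) 'X^(code_area x))).
    by rewrite sig_big_dep.
  by move=> k _; rewrite code_gf.
rewrite coef_sum -sum1_card -natz natr_sum big_mkcond /=; apply: eq_bigr => t _.
by rewrite coefXn inE eq_sym; case: eqP.
Qed.

Lemma offset_top k (x : strata_code D n k) l : offset x k l = 0%N.
Proof. by rewrite /offset insubF ?ltnn. Qed.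

Lemma code_inj (t t' : stack_code D n) : tag t = tag t' :> nat ->
  (forall j l, (j < (tag t).+1)%N ->
     offset (tagged t) j l = offset (tagged t') j l /\
     extent (tagged t) j l = extent (tagged t') j l) -> t = t'.
Proof.
case: t t' => k [f g] [k' [f' g']] /= /val_inj kk'; case: k' / kk' f' g' => f' g' E.
congr existT; congr pair; apply/ffunP.
  move=> [j l]; have [] := E j l (ltnW (ltn_ord j)).
  rewrite /offset /extent valK /= => /val_inj e1 /val_inj e2.
  by rewrite [LHS]surjective_pairing [RHS]surjective_pairing e1 e2.
move=> l; have [_] := E k l (ltnSn k).
by rewrite /extent insubF ?ltnn //= => /val_inj.
Qed.

Lemma code_surj k (o r : nat -> 'I_D -> nat) : (k < n)%N ->
  (forall l, o k l = 0%N) -> (forall j l, (j <= k)%N -> (o j l + r j l <= n)%N) ->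
  exists t : stack_code D n, tag t = k :> nat /\ forall j l, (j <= k)%N ->
    offset (tagged t) j l = o j l /\ extent (tagged t) j l = r j l.
Proof.
move=> lt_kn o_top bnd.
pose x : strata_code D n k := ([ffun p : 'I_k * 'I_D => (inord (o p.1 p.2), inord (r p.1 p.2))],
                               [ffun l => inord (r k l)]).
exists (Tagged (fun k : 'I_n => strata_code D n k) (x : strata_code D n (Ordinal lt_kn))).
split=> //= j l le_jk; have := bnd j l le_jk => bj.
move: (le_jk); rewrite leq_eqVlt /offset /extent => /orP[/eqP jk|lt_jk].
  by rewrite jk insubF ?ltnn // o_top ffunE inordK // -jk; lia.
by rewrite insubT /= !ffunE /= !inordK //; lia.
Qed.

End Code.

Lemma eq_base {D} (o o' : nat -> 'I_D -> nat) j l :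
  (forall i, (i < j)%N -> o i l = o' i l) -> base o j l = base o' j l.
Proof. by move=> oo'; apply: eq_bigr => i _; apply: oo'. Qed.

Lemma eq_stack {D} w w' (o o' r r' : nat -> 'I_D -> nat) c : w = w' ->
  (forall j l, (j < w)%N -> o j l = o' j l /\ r j l = r' j l) ->
  stack w o r c <-> stack w' o' r' c.
Proof.
move=> <- E.
have baseE j l : (j < w)%N -> base o j l = base o' j l.
  by move=> lt_jw; apply: eq_base => i lt_ij; have [] := E i l (ltn_trans lt_ij lt_jw).
split=> -[j lt_jw [c0 cP]]; exists j => //; split=> // l; have [oj rj] := E j l lt_jw.
  by rewrite -oj -rj -baseE.
by rewrite oj rj baseE.
Qed.

Lemma eq_area {D} w w' (o o' r r' : nat -> 'I_D -> nat) : w = w' ->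
  (forall j l, (j < w)%N -> o j l = o' j l /\ r j l = r' j l) ->
  area w o r = area w' o' r'.
Proof.
move=> <- E; apply: eq_bigr => j _; apply: eq_bigr => l _.
by have [-> ->] := E j l (ltn_ord j).
Qed.

Lemma area_ge {D} w (o r : nat -> 'I_D -> nat) j l :
  (j < w)%N -> (o j l + r j l < area w o r)%N.
Proof.
move=> lt_jw; rewrite /area (bigD1 (Ordinal lt_jw)) //= (bigD1 l) //=; lia.
Qed.

Lemma area_width {D} w (o r : nat -> 'I_D -> nat) :
  (0 < D)%N -> (w <= area w o r)%N.
Proof.
move=> D_gt0; rewrite /area -[X in (X <= _)%N]card_ord -sum1_card.
apply: leq_sum => j _; rewrite (bigD1 (Ordinal D_gt0)) //=; lia.
Qed.

(** One pile per code gives the list of representatives: [stack_inj] and [code_inj] make them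
    pairwise inequivalent, [dpp_stack] and [code_surj] make them exhaustive. *)
Lemma num_dpp_code D n : (0 < D)%N ->
  num_dpp D.+1 n #|[pred t : stack_code D n | code_area (tagged t) == n]|.
Proof.
move=> D_gt0; set A := [pred t | _].
have mkS (t : stack_code D n) : exists S : cellset D.+1, forall c,
    c \in S <-> stack (tag t).+1 (offset (tagged t)) (extent (tagged t)) c.
  exact: stack_list.
have [S SP] := fin_all_exists mkS.
have areaS t : lateral_area (S t) = code_area (tagged t).
  apply: (lateral_area_stack _ _ _ 0) => c; rewrite subr0; exact: SP.
exists [seq S t | t <- enum A]; split.
- by rewrite size_map -cardE.
- move=> S0 /mapP [t]; rewrite mem_enum => /eqP tn ->; split; last by rewrite areaS.
  exact: stack_dpp (SP t).
- move=> i j lt_i lt_j ij [v trv]; apply: ij; rewrite !cardE in lt_i lt_j.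
  (* A default element for [nth] on codes, available because the list has an index [i]. *)
  have [t0 _] : exists t0 : stack_code D n, true by case: (enum A) lt_i => // t _; exists t.
  move: trv; rewrite !(nth_map t0) // => trv.
  apply/eqP; rewrite -(nth_uniq t0 lt_i lt_j (enum_uniq _)); apply/eqP.
  set t := nth t0 _ i in trv *; set t' := nth t0 _ j in trv *.
  have [||c|ww' E] := stack_inj _ (offset (tagged t)) (extent (tagged t)) _
     (offset (tagged t')) (extent (tagged t')) (finfun v : cell D.+1)
     (ltn0Sn (tag t)) (ltn0Sn (tag t')).
  + by move=> l; rewrite offset_top.
  + by move=> l; rewrite offset_top.
  + rewrite -SP -SP trv; split=> [h|[c0 Sc0 cE]].
      by exists (c - finfun v) => // i'; rewrite cell_subE ffunE subrK.
    suff -> : c - finfun v = c0 by [].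
    by apply/ffunP => i'; rewrite cell_subE ffunE cE addrK.
  + apply: code_inj => [|j' l' lt_j']; first by case: ww'.
    exact: E.
move=> S' /dpp_stack [w [o [r [v [w_gt0 o_top S'P]]]]] S'n.
case: w w_gt0 o_top S'P => // k _ o_top S'P.
have an : area k.+1 o r = n by rewrite -S'n (lateral_area_stack _ _ _ _ _ S'P).
have [||j l le_jk|t [tk tE]] := @code_surj D n k o r.
- by rewrite -an area_width.
- exact: o_top.
- by rewrite -an ltnW ?area_ge.
have eqtk : k.+1 = (tag t).+1 by rewrite tk.
have eqt j l : (j < k.+1)%N ->
    o j l = offset (tagged t) j l /\ r j l = extent (tagged t) j l.
  by move=> /(tE j l) [-> ->].
exists (S t).
  apply/mapP; exists t => //; rewrite mem_enum inE; apply/eqP.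
  by rewrite -[RHS]an; apply/esym/eq_area.
exists v => c; rewrite S'P (eq_stack _ _ _ _ _ _ _ eqtk eqt) -SP.
split=> [h|[c0 Sc0 cE]].
  by exists (c - v) => // i; rewrite cell_subE subrK.
suff -> : c - v = c0 by [].
by apply/ffunP => i; rewrite cell_subE cE addrK.
Qed.

(* P_d(t) = sum_{n>=1} a_n t^n equals gf_num/gf_den, stated as the formal power
   series identity P_d(t) * gf_den(t) = gf_num(t) (gf_den has constant term 1,
   so this determines the coefficients uniquely). *)
Theorem theorem4 (d : nat) (hd : (3 <= d)%N) :
  exists a : nat -> nat,
    [/\ a 0%N = 0%N,
        forall n : nat, (0 < n)%N -> num_dpp d n (a n)
      & forall n : nat,
          \sum_(k < n.+1) (a k)%:Z * (gf_den d)`_(n - k) = (gf_num d)`_n].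
Proof.
case: d hd => // D hd; have D_gt0 : (0 < D)%N by case: D hd.
exists (fun n => #|[pred t : stack_code D n | code_area (tagged t) == n]|); split.
(* At [n = 0] there are no codes, since ['I_0] is empty. *)
- by apply: eq_card0 => -[[]].
- by move=> n _; apply: num_dpp_code.
(* The convolution is compared termwise at truncation order [n], while [a k] is a coefficient at
   order [k]. *)
move=> n; rewrite -(stack_gf_eq D n D_gt0 n (ltnSn n)) coefM; apply: eq_bigr => k _.
by rewrite card_code (stack_gf_stable _ k n) // -ltnS.
Qed.
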